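(* Let $(\Omega,\mathcal{A},\mu)$ be a $\sigma$-finite measure space, decomposed as a disjoint union $\Omega=\Omega_d\cup\Omega_a$ with $\Omega_d,\Omega_a\in\mathcal{A}$, where the restriction of $\mu$ to $\Omega_d$ is diffuse and $\Omega_a=\bigcup_{n\in\mathbb{N}}B_n$ is the union of a disjoint sequence $(B_n)_{n\in\mathbb{N}}$ of atoms. Let $u\in L_\infty(\mu)$ and let $M_u$ be the multiplication operator $M_uf:=uf$ on $L_1(\mu)$. Then \[ \|M_u\|_{e}=\max\Bigl\{\|u|_{\Omega_d}\|_\infty,\ \limsup_{n\to\infty}|u(B_n)|\Bigr\}, \] where $\|M_u\|_{e}:=\inf\{\|M_u+K\| : K \text{ a compact operator on } L_1(\mu)\}$.
   Context: A measure restricted to $\Omega_d$ is diffuse if every measurable $A\subseteq\Omega_d$ with $\mu(A)>0$ contains a measurable $A'$ with $0<\mu(A')<\mu(A)$. A measurable set $B$ is an atom if every measurable subset $B'\subseteq B$ satisfies $\mu(B')\in\{0,\mu(B)\}$. For each $n$, $u(B_n)$ denotes the a.e.-constant value of $u$ on $B_n$; if $\mu(B_n)=0$, the convention $u(B_n):=0$ is used. $\|u|_{\Omega_d}\|_\infty$ is the $L_\infty$-norm of the restriction of $u$ to $\Omega_d$. *)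

(* Defs.v *)
From HB Require Import structures.
From mathcomp Require Import all_boot all_order all_algebra.
From mathcomp Require Import all_classical all_reals all_analysis.
Set Implicit Arguments. Unset Strict Implicit. Unset Printing Implicit Defensive.
Import Order.TTheory GRing.Theory Num.Theory.
Import numFieldNormedType.Exports.
Local Open Scope classical_set_scope.
Local Open Scope ring_scope.

Section defs.
Context {d : measure_display} {T : measurableType d} {R : realType}.
Variable mu : {measure set T -> \bar R}.

Definition diffuse_on (D : set T) : Prop :=
  forall A, measurable A -> A `<=` D -> (0 < mu A)%E ->
    exists A', [/\ measurable A', A' `<=` A & (0 < mu A' < mu A)%E].

Definition is_atom (B : set T) : Prop :=
  measurable B /\
  forall B', measurable B' -> B' `<=` B -> mu B' = 0%E \/ mu B' = mu B.

Definition atom_value (u : T -> R) (B : set T) : R :=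
  if mu B == 0%E then 0
  else xget 0 [set c : R | {ae mu, forall x, B x -> u x = c}].

Definition L1norm (f : T -> R) : \bar R := Lnorm mu 1 (EFin \o f).

Definition inL1 (f : T -> R) : Prop := f \in Lfun mu 1.

(** A map on representatives defines an operator on L_1(mu) (the space of
    a.e.-classes): it maps L_1 into L_1, is compatible with a.e. equality,
    and is linear modulo a.e. equality. *)
Definition L1_operator (A : (T -> R) -> (T -> R)) : Prop :=
  [/\ forall f, inL1 f -> inL1 (A f),
      forall f g, inL1 f -> inL1 g -> f = g %[ae mu] -> A f = A g %[ae mu]
    & forall (a : R) f g, inL1 f -> inL1 g ->
        A (fun x => a * f x + g x) = (fun x => a * A f x + A g x) %[ae mu]].

Definition L1_opnorm (A : (T -> R) -> (T -> R)) : \bar R :=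
  ereal_sup [set L1norm (A f) | f in [set f | inL1 f /\ (L1norm f <= 1)%E]].

Definition L1_compact (K : (T -> R) -> (T -> R)) : Prop :=
  L1_operator K /\
  forall f : nat -> T -> R, (forall n, inL1 (f n) /\ (L1norm (f n) <= 1)%E) ->
    exists (phi : nat -> nat) (g : T -> R),
      [/\ {homo phi : m n / (m < n)%N >-> (m < n)%N}, inL1 g
        & L1norm (fun x => K (f (phi n)) x - g x) @[n --> \oo] --> 0%E].

Definition mult_op (u : T -> R) : (T -> R) -> (T -> R) :=
  fun f x => u x * f x.

Definition L1_essnorm (A : (T -> R) -> (T -> R)) : \bar R :=
  ereal_inf [set L1_opnorm (fun f x => A f x + K f x) | K in L1_compact].

End defs.

(* Main.v *)
Require Import Defs.
From HB Require Import structures.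
From mathcomp Require Import all_boot all_order all_algebra.
From mathcomp Require Import all_classical all_reals all_analysis.
From mathcomp Require Import measurable_realfun ess_sup_inf.
Import Order.TTheory GRing.Theory Num.Theory.
Import numFieldNormedType.Exports.
Local Open Scope classical_set_scope.
Local Open Scope ring_scope.

(** Upper bound: subtracting from [M_u] the finite-rank operator which, on each of
    the first [N] atoms, multiplies the mean of [f] by [u(B_n)] leaves the operator
    of multiplication by [u] off these atoms, because an integrable function is
    a.e. equal to its mean on an atom of finite measure.

    Lower bound: if [|u| >= c] on pairwise disjoint sets [A_n] of positive finite
    measure, let [f_n] be the normalized indicator of [A_n]. Along a subsequence
    [K f_n] converges in [L_1] to some [g], and the integral of [|g|] over [A_n]
    tends to [0] since [g] is integrable, so [c <= ||M_u + K||] by restricting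
    [(M_u + K) f_n] to [A_n]. Such sets [A_n] exist inside every non-null subset
    of the diffuse part and among the atoms. *)

Lemma increasing_cvg_infty {phi : nat -> nat} :
  {homo phi : m n / (m < n)%N >-> (m < n)%N} -> phi @ \oo --> \oo.
Proof.
move=> phiS; have phi_ge n : (n <= phi n)%N.
  by elim: n => // n IH; exact: leq_ltn_trans IH (phiS _ _ (ltnSn n)).
move=> A [N _ NA]; exists N => // n /= Nn; apply: NA => /=.
exact: leq_trans Nn (phi_ge n).
Qed.

(** * Integrable functions and the $L_1$ norm *)

Section L1.
Context {d : measure_display} {T : measurableType d} {R : realType}.
Variable mu : {measure set T -> \bar R}.
Implicit Types (f g h : T -> R) (K : (T -> R) -> T -> R).

Lemma L1normE f : L1norm mu f = (\int[mu]_x `|(f x)%:E|)%E.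
Proof. exact: Lnorm1. Qed.

Lemma L1norm_ge0 f : (0 <= L1norm mu f)%E.
Proof. exact: Lnorm_ge0. Qed.

Lemma inL1P f : inL1 mu f <-> mu.-integrable setT (EFin \o f).
Proof. exact: Lfun1_integrable. Qed.

Lemma inL1_measurable {f} : inL1 mu f -> measurable_fun setT f.
Proof. by move=> /inL1P/integrableP[/measurable_EFinP]. Qed.

Lemma inL1_lin (a : R) {f g} : inL1 mu f -> inL1 mu g ->
  inL1 mu (fun x => a * f x + g x).
Proof.
move=> /inL1P fi /inL1P gi; apply/inL1P.
exact: (integrableD measurableT (integrableZl measurableT a fi) gi).
Qed.

Lemma inL1_0 : inL1 mu (fun=> 0).
Proof. by apply/inL1P; exact: integrable0. Qed.

Lemma L1norm0 : L1norm mu (fun=> 0) = 0%E.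
Proof. by rewrite L1normE; apply: integral0_eq => x _; rewrite abse0. Qed.

Lemma inL1Z (a : R) {f} : inL1 mu f -> inL1 mu (fun x => a * f x).
Proof.
move=> fi; have := inL1_lin a fi inL1_0; congr (inL1 mu _).
by apply/funext => x; rewrite addr0.
Qed.

Lemma inL1_indic {A} : measurable A -> (mu A < +oo)%E -> inL1 mu \1_A.
Proof.
move=> mA Aoo; apply/inL1P/integrableP; split.
  by apply/measurable_EFinP; exact: measurable_indic.
under eq_integral do rewrite /= ger0_norm//.
by rewrite integral_indic// setIT.
Qed.

Lemma L1normZ (a : R) {f} : inL1 mu f ->
  L1norm mu (fun x => a * f x) = (`|a|%:E * L1norm mu f)%E.
Proof.
move=> /inL1_measurable mf; rewrite !L1normE -ge0_integralZl//.
- by apply: eq_integral => x _; rewrite EFinM abseM.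
- by apply/measurable_EFinP; exact: measurableT_comp.
Qed.

Lemma L1norm_triangle {f g} : measurable_fun setT f -> measurable_fun setT g ->
  (L1norm mu (fun x => (f x + g x)%R) <= L1norm mu f + L1norm mu g)%E.
Proof. by move=> mf mg; exact: minkowski_EFin. Qed.

Lemma Rintegral_inL1 {A f} : measurable A -> inL1 mu f ->
  mu.-integrable A (EFin \o f).
Proof. by move=> mA /inL1P; exact: integrableS. Qed.

Lemma normr_Rintegral_le_L1norm {A f} : measurable A -> inL1 mu f ->
  (`|(\int[mu]_(x in A) f x)%R|%:E <= L1norm mu f)%E.
Proof.
move=> mA fi; have fA := Rintegral_inL1 mA fi.
rewrite EFin_normr_Rintegral// (le_trans (le_abse_integral _ _ _))//.
  by case/integrableP: fA.
rewrite L1normE ge0_subset_integral//.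
by apply/measurable_EFinP; exact: measurableT_comp (inL1_measurable fi).
Qed.

(** * Compact operators: sums and rank one *)

Lemma L1_compact0 : L1_compact mu (fun _ _ => 0).
Proof.
split.
  split=> [f _|f g _ _ _|a f g _ _]; first exact: inL1_0.
    exact: nearW.
  by apply: nearW => x _; rewrite mulr0 addr0.
move=> f _; exists id, (fun=> 0); split => //; first exact: inL1_0.
have -> : (fun x : T => (0 - 0 : R)) = fun=> 0 by apply/funext => x; rewrite subr0.
by rewrite L1norm0; exact: cvg_cst.
Qed.

(** A subsequence that works for [K1] is refined to one that also works for [K2]; the triangle
    inequality bounds the error by the sum of the two errors. *)
Lemma L1_compactD {K1 K2} : L1_compact mu K1 -> L1_compact mu K2 ->
  L1_compact mu (fun f x => K1 f x + K2 f x).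
Proof.
move=> [[K11 K1ae K1l] K1c] [[K21 K2ae K2l] K2c]; split.
  split=> [f fi|f g fi gi fg|a f g fi gi].
  - have := inL1_lin 1 (K11 _ fi) (K21 _ fi); congr (inL1 mu _).
    by apply/funext => x; rewrite mul1r.
  - have := K1ae f g fi gi fg; have := K2ae f g fi gi fg.
    by apply: filterS2 => x K2E K1E _; rewrite K2E// K1E.
  - have := K1l a f g fi gi; have := K2l a f g fi gi.
    apply: filterS2 => x K2E K1E _; rewrite K2E// K1E//.
    by rewrite mulrDr addrACA.
move=> f f1.
have [p1 [g1 [p1S g1i g1c]]] := K1c f f1.
have [p2 [g2 [p2S g2i g2c]]] := K2c (f \o p1) (fun n => f1 (p1 n)).
(* The factor [1] gives the limit the shape of [inL1_lin]. *)
exists (p1 \o p2), (fun x => 1 * g1 x + g2 x); split.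
- by move=> m n mn /=; apply/p1S/p2S.
- exact: inL1_lin.
have g1c' := cvg_comp _ _ (increasing_cvg_infty p2S) g1c.
have zz : ((0 : \bar R) +? 0)%E by [].
have /(_ _) c0 := cvgeD zz g1c' g2c.
rewrite adde0 in c0; apply: (squeeze_cvge _ (cvg_cst 0%E) c0).
apply: nearW => n; rewrite L1norm_ge0/=.
have mK1 := inL1_measurable (K11 _ (f1 (p1 (p2 n))).1).
have mK2 := inL1_measurable (K21 _ (f1 (p1 (p2 n))).1).
rewrite (_ : (fun x => _) = (fun x => (K1 (f (p1 (p2 n))) x - g1 x)
   + (K2 (f (p1 (p2 n))) x - g2 x))).
  by apply: L1norm_triangle; apply: measurable_funB => //; exact: inL1_measurable.
by apply/funext => x; rewrite mul1r opprD addrACA.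
Qed.

(** On the unit ball the coefficients $\int_A f_n$ lie in $[-1,1]$, so by Bolzano-Weierstrass a
    subsequence of them converges to some $l$, and the images converge to $l h$. *)
Lemma L1_compact_rank1 {A h} : measurable A -> inL1 mu h ->
  L1_compact mu (fun f x => (\int[mu]_(y in A) f y)%R * h x).
Proof.
move=> mA hi; split.
  split=> [f fi|f g fi gi fg|a f g fi gi].
  - exact: inL1Z.
  - apply: nearW => x _; congr (fine _ * _); apply: ae_eq_integral => //.
    + by apply/measurable_EFinP/measurable_funTS/inL1_measurable.
    + by apply/measurable_EFinP/measurable_funTS/inL1_measurable.
    + by move: fg; apply: filterS => y fg _; rewrite fg.
  - apply: nearW => x _; rewrite RintegralD//.
    + by rewrite RintegralZl ?mulrDl ?mulrA//; exact: Rintegral_inL1.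
    + by apply: (Rintegral_inL1 mA); exact: inL1Z.
    + exact: Rintegral_inL1.
move=> f f1; pose c n := (\int[mu]_(y in A) f n y)%R.
have [|p pS /cvg_ex[l cl]] := @bolzano_weierstrass R c.
  exists 1; split => // M M1 n _ /=; rewrite (le_trans _ (ltW M1))//.
  rewrite -lee_fin (le_trans (normr_Rintegral_le_L1norm mA _))//.
    exact: (f1 n).1.
  exact: (f1 n).2.
exists p, (fun x => l * h x); split.
- by move=> m n; rewrite !ltnNge -pS.
- exact: inL1Z.
have E n : L1norm mu (fun x => c (p n) * h x - l * h x) =
    (`|c (p n) - l|%:E * L1norm mu h)%E.
  by rewrite -L1normZ//; congr L1norm; apply/funext => x; rewrite mulrBl.
have hfin : L1norm mu h \is a fin_num.
  rewrite ge0_fin_numE ?L1norm_ge0// L1normE.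
  by move/inL1P: hi => /integrableP[].
have lim0 : (`|c (p n) - l|%:E * L1norm mu h)%E @[n --> \oo] --> 0%E.
  rewrite -(mul0e (L1norm mu h)); apply: cvgeZr => //.
  apply: cvg_EFin; first exact: nearW.
  by apply/norm_cvg0P/subr_cvg0.
by apply: cvg_trans lim0; apply: near_eq_cvg; apply: nearW => n; rewrite -E.
Qed.

(** * Lower bounds for the operator norm from disjoint sets *)

Lemma integral_trivIset_cvg0 {A : nat -> set T} {g} :
  trivIset setT A -> (forall n, measurable (A n)) -> inL1 mu g ->
  (\int[mu]_(x in A n) `|(g x)%:E|)%E @[n --> \oo] --> 0%E.
Proof.
move=> tA mA gi; pose t n := (\int[mu]_(x in A n) `|(g x)%:E|)%E.
have mg : measurable_fun setT (fun x => `|(g x)%:E|)%E.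
  by apply/measurable_EFinP; exact: measurableT_comp (inL1_measurable gi).
have t0 n : (0 <= t n)%E by exact: integral_ge0.
(* The integrals sum to the integral of $|g|$ over the union, which is finite; hence the tails of
   the series vanish, and [t n] is the first term of the tail from [n]. *)
have toc : (\sum_(0 <= k <oo) t k < +oo)%E.
  rewrite -ge0_integral_bigcup//; last exact: measurable_funTS.
  move/inL1P: gi => /integrableP[_]; apply: le_lt_trans.
  by apply: ge0_subset_integral => //; exact: bigcup_measurable.
have /(_ _ _) tail := nneseries_tail_cvg toc (fun k _ => t0 k).
apply: (squeeze_cvge _ (cvg_cst 0%E) tail).
apply: nearW => n; rewrite t0/=.
have := @nneseries_lim_ge R t xpredT n n.+1 (fun k _ _ => t0 k).
by rewrite big_nat1.
Qed.

Lemma L1_opnorm_ub (A : (T -> R) -> T -> R) f : inL1 mu f ->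
  (L1norm mu f <= 1)%E -> (L1norm mu (A f) <= L1_opnorm mu A)%E.
Proof. by move=> fi f1; apply: ereal_sup_ubound; exists f. Qed.

Lemma L1norm_indic {A} : measurable A -> L1norm mu \1_A = mu A.
Proof.
move=> mA; rewrite L1normE; under eq_integral do rewrite /= ger0_norm//.
by rewrite integral_indic// setIT.
Qed.

(** This criterion serves both the diffuse part and the atoms. The bound on [u] is only asked almost
    everywhere because [u] equals its value on an atom only up to a null set. *)
Lemma opnorm_ge_disjoint {u : T -> R} {c : R} {A : nat -> set T} {K} :
  measurable_fun setT u -> L1_compact mu K -> 0 <= c ->
  trivIset setT A -> (forall n, measurable (A n)) ->
  (forall n, (0 < mu (A n) < +oo)%E) ->
  (forall n, {ae mu, forall x, A n x -> c <= `|u x|}) ->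
  (c%:E <= L1_opnorm mu (fun f x => (mult_op u f x + K f x)%R))%E.
Proof.
move=> um [[K1 _ _] Kc] c0 tA mA A0 uc.
set X := L1_opnorm _ _.
pose r n := fine (mu (A n)).
have rE n : mu (A n) = (r n)%:E.
  by have /andP[a b] := A0 n; rewrite fineK// ge0_fin_numE.
have r0 n : 0 < r n by have /andP[+ _] := A0 n; rewrite rE lte_fin.
pose f n := fun x => (r n)^-1 * \1_(A n) x : R.
have iA n : inL1 mu \1_(A n) by apply: inL1_indic => //; case/andP: (A0 n).
have fi n : inL1 mu (f n) by exact: inL1Z.
have f1 n : L1norm mu (f n) = 1%E.
  rewrite L1normZ// L1norm_indic// rE ger0_norm ?invr_ge0 ?ltW//.
  by rewrite -EFinM mulVf// gt_eqF.
have [p [g [pS gi gc]]] : exists p g, [/\ {homo p : m n / (m < n)%N >-> (m < n)%N},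
    inL1 mu g & L1norm mu (fun x => K (f (p n)) x - g x) @[n --> \oo] --> 0%E].
  by apply: Kc => n; split; rewrite ?f1.
have tc := cvg_comp _ _ (increasing_cvg_infty pS)
  (integral_trivIset_cvg0 tA mA gi).
have zz : ((0 : \bar R) +? 0)%E by [].
have /(_ _) et := cvgeD zz gc tc; rewrite adde0 in et.
have X0 : (0 <= X)%E.
  by apply: le_trans (L1_opnorm_ub _ _ (fi 0%N) _); rewrite ?L1norm_ge0// f1.
have [->|Xoo] := eqVneq X +oo%E; first exact: leey.
have zX : (X +? 0)%E by rewrite fin_num_adde_defl.
(* The sum of [X] and the two vanishing errors tends to [X], so it suffices to bound [c] by each of
   these sums. *)
have /(_ _ _) lim := cvgeD zX (cvg_cst X) et; rewrite adde0 in lim.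
apply: (cvge_ge _ lim); apply: nearW => n; set k := p n.
have mf := inL1_measurable (fi k); have mK := inL1_measurable (K1 _ (fi k)).
have mg := inL1_measurable gi.
pose v x := `|(u x * f k x + K (f k) x)%:E|%E.
pose w x := `|(K (f k) x - g x)%:E|%E.
pose z x := `|(g x)%:E|%E.
have mv D : measurable_fun D v.
  apply: measurable_funTS; apply/measurable_EFinP/measurableT_comp => //.
  by apply: measurable_funD => //; exact: measurable_funM.
have mw D : measurable_fun D w.
  apply: measurable_funTS; apply/measurable_EFinP/measurableT_comp => //.
  exact: measurable_funB.
have mz D : measurable_fun D z.
  by apply: measurable_funTS; apply/measurable_EFinP/measurableT_comp.
have mwz D : measurable_fun D (fun x => w x + z x)%E by exact: emeasurable_funD.
have v0 x : (0 <= v x)%E by exact: abse_ge0.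
have w0 x : (0 <= w x)%E by exact: abse_ge0.
have z0 x : (0 <= z x)%E by exact: abse_ge0.
have wz0 x : (0 <= w x + z x)%E by exact: adde_ge0.
have cE : c%:E = (\int[mu]_(x in A k) (c * (r k)^-1)%:E)%E.
  by rewrite integral_cst// rE -EFinM -mulrA mulVf ?mulr1// gt_eqF.
(* On $A_k$, $c/r_k \le |u f_k| \le |u f_k + K f_k| + |K f_k - g| + |g|$; the left side integrates
   to $c$. *)
have le1 : (c%:E <= \int[mu]_(x in A k) (v x + (w x + z x)))%E.
  rewrite cE; apply: ae_ge0_le_integral => //.
  - by move=> x _; rewrite lee_fin mulr_ge0// invr_ge0 ltW.
  - by move=> x _; rewrite adde_ge0.
  - exact: emeasurable_funD.
  apply: filterS (uc k) => x cux Ax; rewrite -!EFinD lee_fin.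
  have fE : f k x = (r k)^-1 by rewrite /f indicE mem_set// mulr1.
  have -> : c * (r k)^-1 = c * `|f k x| by rewrite fE ger0_norm// invr_ge0 ltW.
  apply: (@le_trans _ _ (`|u x * f k x|)).
    by rewrite [leRHS]normrM ler_wpM2r// cux.
  rewrite [X in `|X| <= _](_ : _ = (u x * f k x + K (f k) x)
    + (- (K (f k) x - g x) - g x)); last first.
    by rewrite opprB [X in _ + X]addrAC subrr sub0r addrK.
  rewrite (le_trans (ler_normD _ _))// lerD2l (le_trans (ler_normD _ _))//.
  by rewrite !normrN.
apply: (le_trans le1).
rewrite ge0_integralD// ge0_integralD//; apply: leeD; [|apply: leeD => //].
- apply: le_trans (L1_opnorm_ub _ _ (fi k) _); last by rewrite f1.
  by rewrite L1normE; apply: ge0_subset_integral.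
- by rewrite L1normE; apply: ge0_subset_integral.
Qed.

(** * Disjoint sets of positive finite measure in the diffuse part *)

Lemma diffuse_disjoint_seq {D A : set T} : diffuse_on mu D ->
  measurable A -> A `<=` D -> (0 < mu A)%E ->
  exists E : nat -> set T, [/\ trivIset setT E, forall n, measurable (E n),
    forall n, E n `<=` A & forall n, (0 < mu (E n) < +oo)%E].
Proof.
move=> dif mA AD A0.
pose P X := [/\ measurable X, X `<=` A & (0 < mu X)%E].
have /choice[next nextP] : forall X, exists Y, P X ->
    [/\ measurable Y, Y `<=` X & (0 < mu Y < mu X)%E].
  move=> X; have [[mX XA X0]|nPX] := pselect (P X); last by exists X.
  by have [Y ?] := dif X mX (subset_trans XA AD) X0; exists Y.
(* The chain starts one step below [A]: each [S n] has measure strictly below that of its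
   predecessor, hence finite, even if [mu A] is infinite. *)
pose S n := iter n.+1 next A.
have PA : P A by split.
have step n : P (iter n next A) -> P (iter n.+1 next A).
  move=> /[dup] [[_ XA _]] /nextP[mY YX /andP[Y0 _]]; split => //.
  exact: subset_trans YX XA.
have PI n : P (iter n next A) by elim: n => // n IH; exact: step.
have PS n : P (S n) by exact: PI.
have Soo n : (mu (S n) < +oo)%E.
  by have [_ _ /andP[_ /lt_le_trans]] := nextP _ (PI n); apply; exact: leey.
have SS n : [/\ measurable (S n.+1), S n.+1 `<=` S n
    & (0 < mu (S n.+1) < mu (S n))%E] by exact: nextP (PS n).
have Sdec m n : (m <= n)%N -> S n `<=` S m.
  move=> /subnK <-; elim: (n - m)%N => // i IH; rewrite addSn.
  by have [_ + _] := SS (i + m)%N; move=> /subset_trans; exact.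
have mS n : measurable (S n) by have [] := PS n.
(* Differences of consecutive sets of a decreasing chain are disjoint, and the strict drop in
   measure makes them non-null. *)
exists (fun n => S n `\` S n.+1); split.
- apply/trivIsetP => i j _ _.
  wlog ij : i j / (i < j)%N => [wl|_].
    by rewrite neq_ltn => /orP[] ij; [|rewrite setIC]; apply: wl; rewrite ?neq_ltn ?ij.
  by rewrite -subset0 => x [[_ nS] [Sj _]]; apply: nS; exact: Sdec Sj.
- by move=> n; exact: measurableD.
- by move=> n x [Sx _]; have [_ + _] := PS n; exact.
- move=> n; have [_ S1 /andP[_ lt]] := SS n.
  rewrite measureD ?Soo// (setIidr S1) sube_gt0 lt/=.
  by rewrite (le_lt_trans _ (Soo n))// geeDl// oppe_le0.
Qed.

(** * Atoms: finite measure and almost everywhere constant functions *)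

Lemma atom_finite {B} : sigma_finite setT mu -> is_atom mu B -> (mu B < +oo)%E.
Proof.
move=> [F FT mF] [mB atom]; rewrite ltey; apply/negP => /eqP Boo.
suff : mu B = 0%E by rewrite Boo.
(* An atom of infinite measure would meet each [F n] in a set of measure $0$ or $+\infty$; the
   latter exceeds [mu (F n)], so [B] would be a countable union of null sets. *)
have BF : B = \bigcup_n (B `&` F n) by rewrite -setI_bigcupr -FT setIT.
apply/negligibleP => //; rewrite BF; apply: negligible_bigcup => n.
have mBF : measurable (B `&` F n) by apply: measurableI => //; exact: (mF n).1.
apply/negligibleP => //; have [//|BFB] := atom _ mBF (@subIsetl _ _ _).
have : (mu (B `&` F n) <= mu (F n))%E.
  by apply: le_measure; rewrite ?inE//; exact: (mF n).1.
by rewrite BFB Boo leye_eq => /eqP Foo; have := (mF n).2; rewrite Foo ltxx.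
Qed.

(* If [f] exceeded its mean on a non-null part of the atom, it would do so almost
   everywhere, although [f] minus its mean has zero integral. *)
Lemma atom_le_mean {B f} : is_atom mu B -> (mu B < +oo)%E ->
  mu.-integrable B (EFin \o f) ->
  {ae mu, forall x, B x -> f x <= (\int[mu]_(y in B) f y)%R / fine (mu B)}.
Proof.
move=> [mB atom] Boo fi; set c := _ / _.
have mf : measurable_fun B f by apply/measurable_EFinP/(measurable_int mu).
have mg : measurable_fun B (fun x => f x - c) by exact: measurable_funB.
pose C := B `&` [set x | c < f x].
have mC : measurable C.
  rewrite (_ : C = B `&` (fun x => f x - c) @^-1` `]0, +oo[); first exact: mg.
  by apply/seteqP; split=> x [Bx /=]; rewrite in_itv/= andbT subr_gt0.
have [C0|CB] := atom _ mC (@subIsetl _ _ _).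
  exists C; split => // x /= /not_implyP[Bx /negP]; rewrite -ltNge => cf.
  by split.
have [B0|Bn0] := eqVneq (mu B) 0%E.
  by exists B; split => // x /= /not_implyP[].
exfalso; move/eqP: (Bn0); apply.
have BC0 : mu (B `\` C) = 0%E.
  have CsubB : C `<=` B by exact: subIsetl.
  by rewrite measureD ?Boo// (setIidr CsubB) [X in (_ - X)%E]CB subee// ge0_fin_numE.
have bE : mu B = (fine (mu B))%:E by rewrite fineK// ge0_fin_numE.
have b0 : fine (mu B) != 0 by rewrite -eqe -bE.
have ci : mu.-integrable B (EFin \o cst c).
  apply/integrableP; split; first exact/measurable_EFinP.
  have -> : (\int[mu]_(x in B) `|(EFin \o cst c) x| = `|c|%:E * mu B)%E.
    by rewrite -integral_cst//; exact: eq_integral.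
  by rewrite bE -EFinM ltry.
have gi : mu.-integrable B (fun x => (f x - c)%:E).
  by have := integrableB mB fi ci; apply: eq_integrable => // x _; rewrite /= EFinB.
have Bg0 : (\int[mu]_(x in B) (f x - c)%:E = 0)%E.
  rewrite integralB_EFin// [X in (_ - X)%E]integral_cst// bE -EFinM divfK//.
  by rewrite -(fineK (integrable_fin_num mB fi)) subee.
(* Since [B] minus [C] is null and $f - c > 0$ on [C], this is the zero integral over [B]; it forces
   [C], and with it [B], to be null. *)
have Cg0 : (\int[mu]_(x in C) `|(f x - c)%:E| = 0)%E.
  rewrite -Bg0 (@negligible_integral _ _ _ mu B (B `\` C))//; last exact: measurableD.
  rewrite setDD (setIidr (@subIsetl _ _ _)); apply: eq_integral => x.
  by rewrite inE => -[_ cf]; rewrite gee0_abs// lee_fin subr_ge0; exact: ltW.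
rewrite -CB; apply/negligibleP => //.
have mgC : measurable_fun C (fun x => (f x - c)%:E).
  by apply/measurable_EFinP; apply: measurable_funS mg => //; exact: subIsetl.
have /(ae_eq_integral_abs mu mC mgC) := Cg0.
apply: negligibleS => x Cx /= /(_ Cx) [] /eqP.
by rewrite subr_eq0 gt_eqF//; case: Cx.
Qed.

(** Apply [atom_le_mean] to $f$ and to $-f$. *)
Lemma atom_eq_mean {B f} : is_atom mu B -> (mu B < +oo)%E ->
  mu.-integrable B (EFin \o f) ->
  {ae mu, forall x, B x -> f x = (\int[mu]_(y in B) f y)%R / fine (mu B)}.
Proof.
move=> aB Boo fi; have mB : measurable B by case: aB.
have nfi : mu.-integrable B (EFin \o (fun x => -1 * f x)).
  by have := integrableZl mB (-1) fi; apply: eq_integrable.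
have := atom_le_mean aB Boo nfi; have := atom_le_mean aB Boo fi.
rewrite RintegralZl//; apply: filterS2 => x le1 le2 Bx.
by have := le2 Bx; rewrite !mulN1r mulNr lerN2 => le; apply/le_anti; rewrite le le1.
Qed.

(** The essential bound [M] makes [u] integrable on the atom, so its mean shows that the set from
    which [xget] picks is nonempty. On a null atom every value is correct almost everywhere. *)
Lemma atom_valueP {u : T -> R} {B : set T} (M : R) :
  is_atom mu B -> (mu B < +oo)%E -> measurable_fun setT u ->
  {ae mu, forall x, `|u x| <= M} ->
  {ae mu, forall x, B x -> u x = atom_value mu u B}.
Proof.
move=> aB Boo um uM; have mB : measurable B by case: aB.
rewrite /atom_value; case: ifPn => [/eqP B0|B0].
  by exists B; split => // x /= /not_implyP[].
have ui : mu.-integrable B (EFin \o u).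
  apply/integrableP; split; first exact/measurable_EFinP/measurable_funTS.
  apply: (@le_lt_trans _ _ (\int[mu]_(x in B) `|M|%:E)%E).
    apply: ae_ge0_le_integral => //.
      by apply: measurableT_comp => //; exact/measurable_EFinP/measurable_funTS.
    by apply: filterS uM => x uM _ /=; rewrite lee_fin (le_trans uM)// ler_norm.
  rewrite integral_cst// -(@fineK _ (mu B)) ?ge0_fin_numE//.
  by rewrite -EFinM ltry.
case: xgetP => [c _ uc|no]; first exact: uc.
by case: (no _ (atom_eq_mean aB Boo ui)).
Qed.

End L1.

(** * Real thresholds and limits superior *)

Lemma lee_forall_lt {R : realType} (a X : \bar R) : (0 <= X)%E ->
  (forall c : R, 0 <= c -> (c%:E < a)%E -> (c%:E <= X)%E) -> (a <= X)%E.
Proof.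
move=> X0 aX; rewrite leNgt; apply/negP => Xa.
move: X X0 Xa aX => [r r0 ra aX|_|//]; last by rewrite ltNge leey.
(* Such a [c] exceeds [r], which is nonnegative, so it is an admissible threshold and contradicts
   [aX]. *)
have [c rc ca] : exists2 c : R, r < c & (c%:E < a)%E.
  move: a ra {aX} => [s|_|//]; rewrite ?lte_fin.
    by move=> rs; exists ((r + s) / 2); rewrite ?lte_fin ?midf_lt.
  by exists (r + 1); rewrite ?ltry// ltrDl.
rewrite lee_fin in r0.
by have := aX c (le_trans r0 (ltW rc)) ca; rewrite lee_fin leNgt rc.
Qed.

(** In this form a strict inequality on the limit superior passes to a single tail supremum. *)
Lemma limn_esup_inf {R : realType} (s : nat -> \bar R) :
  limn_esup s = ereal_inf (range (esups s)).
Proof. by rewrite limn_esup_lim; apply/cvg_lim => //; exact: cvg_esups_inf. Qed.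

(** Every tail supremum exceeds [c], so each index can be chosen beyond the previous one.
    Injectivity is what keeps the selected atoms disjoint. *)
Lemma lt_limn_esup_subseq {R : realType} {s : nat -> \bar R} {c : \bar R} :
  (c < limn_esup s)%E ->
  exists2 p : nat -> nat, injective p & forall n, (c < s (p n))%E.
Proof.
rewrite limn_esup_inf => cs.
have /choice[h hP] : forall N, exists n, (N <= n)%N /\ (c < s n)%E.
  move=> N; have : (c < esups s N)%E.
    by apply: lt_le_trans cs _; apply: ereal_inf_lbound; exists N.
  by move=> /ereal_sup_gt[_ [n Nn <-] cn]; exists n.
pose p n := iter n (fun k => h k.+1) (h 0%N).
have pS : {homo p : m n / (m < n)%N >-> (m < n)%N}.
  by apply: homo_ltn; [exact: ltn_trans | move=> n; exact: (hP (p n).+1).1].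
exists p; last by case=> [|n]; exact: (hP _).2.
move=> m n pmn; have [/pS|/pS|//] := ltngtP m n; by rewrite pmn ltnn.
Qed.

(** * Lower and upper bounds for the essential norm *)

Section essential_norm_bounds.
Context {d : measure_display} {T : measurableType d} {R : realType}.
Variable mu : {measure set T -> \bar R}.
Implicit Types (u f g h : T -> R) (K : (T -> R) -> T -> R) (B : nat -> set T).

Lemma L1_opnorm_ge0 {A : (T -> R) -> T -> R} : (0 <= L1_opnorm mu A)%E.
Proof.
apply: le_trans (L1_opnorm_ub mu A (fun=> 0) (inL1_0 mu) _).
  exact: L1norm_ge0.
by rewrite L1norm0.
Qed.

Lemma Lnorm_le_opnorm_diffuse {D : set T} {u K} (mD : measurable D) :
  diffuse_on mu D -> measurable_fun setT u -> L1_compact mu K ->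
  (Lnorm (mrestr mu mD) +oo (EFin \o u) <=
    L1_opnorm mu (fun f x => mult_op u f x + K f x)%R)%E.
Proof.
move=> dif um cK; apply: lee_forall_lt; first exact: L1_opnorm_ge0.
move=> c c0 cu; pose A := D `&` [set x | c < `|u x|].
have mnu : measurable_fun setT (fun x => `|u x|) by exact: measurableT_comp.
have mS : measurable [set x | c < `|u x|].
  rewrite (_ : mkset _ = setT `&` (fun x => `|u x|) @^-1` `]c, +oo[); first exact: mnu.
  by apply/seteqP; split=> x /=; rewrite in_itv/= andbT; [|case].
have mA : measurable A by exact: measurableI.
have A0 : (0 < mu A)%E.
  rewrite lt0e measure_ge0 andbT; apply/eqP => A0.
  (* [Lnorm] at [+oo] is an essential supremum if the restricted measure is nonzero, and $0$
     otherwise. If [A] is null, neither can exceed [c]. *)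
  move: cu; rewrite unlock; case: ifPn => _; last first.
    by rewrite lte_fin ltNge c0.
  apply/negP; rewrite -leNgt; apply/ess_supP.
  exists [set x | c < `|u x|]; split => //.
    by rewrite /= /mrestr setIC.
  by move=> x /= /negP; rewrite -ltNge lte_fin.
have [E [tE mE EA E0]] := diffuse_disjoint_seq mu dif mA (@subIsetl _ _ _) A0.
apply: (opnorm_ge_disjoint mu um cK c0 tE mE E0) => n.
by apply: nearW => x /EA[_ /ltW].
Qed.

Lemma limn_esup_le_opnorm_atoms {B u v K} :
  (forall n, is_atom mu (B n)) -> (forall n, (mu (B n) < +oo)%E) ->
  trivIset setT B -> measurable_fun setT u ->
  (forall n, mu (B n) = 0%E -> v n = 0) ->
  (forall n, {ae mu, forall x, B n x -> u x = v n}) ->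
  L1_compact mu K ->
  (limn_esup (fun n => `|v n|%:E) <=
    L1_opnorm mu (fun f x => mult_op u f x + K f x)%R)%E.
Proof.
move=> aB Boo tB um v0 uv cK; apply: lee_forall_lt; first exact: L1_opnorm_ge0.
move=> c c0 /lt_limn_esup_subseq[p pinj pc].
apply: (@opnorm_ge_disjoint _ _ _ mu u c (B \o p)) => // [|n|n|n].
- apply/trivIsetP => i j _ _ ij; move/trivIsetP: tB; apply => //.
  by apply: contra_neq ij; exact: pinj.
- by have [] := aB (p n).
(* The convention that null atoms have value $0$ enters here: $|v| > c \ge 0$ forces positive
   measure. *)
- rewrite Boo andbT lt0e measure_ge0 andbT; apply/eqP => /v0 v0'.
  by have := pc n; rewrite v0' normr0 lte_fin ltNge c0.
- apply: filterS (uv (p n)) => x ux Bx; rewrite (ux Bx).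
  by have := pc n; rewrite lte_fin => /ltW.
Qed.

Lemma L1_compact_sum_indic {B : nat -> set T} {a : nat -> R} (N : nat) :
  (forall n, measurable (B n)) -> (forall n, (mu (B n) < +oo)%E) ->
  L1_compact mu (fun f x =>
    \sum_(i < N) (\int[mu]_(y in B i) f y)%R * (a i * \1_(B i) x)).
Proof.
move=> mB Boo; elim: N => [|N IH].
  have := L1_compact0 mu; congr L1_compact.
  by apply/funext => f; apply/funext => x; rewrite big_ord0.
have hi : inL1 mu (fun x => a N * \1_(B N) x) by apply: inL1Z; exact: inL1_indic.
have := L1_compactD mu IH (L1_compact_rank1 mu (mB N) hi); congr L1_compact.
by apply/funext => f; apply/funext => x; rewrite big_ord_recr.
Qed.

Lemma essnorm_le {Od Oa : set T} {B u v} (mOd : measurable Od) (N : nat) :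
  Od `&` Oa = set0 -> Od `|` Oa = [set: T] -> Oa = \bigcup_n B n ->
  trivIset setT B ->
  (forall n, is_atom mu (B n)) -> (forall n, (mu (B n) < +oo)%E) ->
  measurable_fun setT u ->
  (forall n, {ae mu, forall x, B n x -> u x = v n}) ->
  (L1_essnorm mu (mult_op u) <=
    maxe (Lnorm (mrestr mu mOd) +oo (EFin \o u)) (esups (fun n => `|v n|%:E) N))%E.
Proof.
move=> OdOa OdUOa OaE tB aB Boo um uv.
have mB n : measurable (B n) by case: (aB n).
set M := maxe _ _.
(* Dividing by the mass turns the integral into the mean; the sign is negative because the essential
   norm adds [K]. *)
pose K (f : T -> R) x :=
  \sum_(i < N) (\int[mu]_(y in B i) f y)%R * (- v i / fine (mu (B i)) * \1_(B i) x).
have cK : L1_compact mu K by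
  exact: (@L1_compact_sum_indic B (fun i => - v i / fine (mu (B i))) N mB Boo).
apply: (@le_trans _ _ (L1_opnorm mu (fun f x => mult_op u f x + K f x))).
  by apply: ereal_inf_lbound; exists K.
apply: ge_ereal_sup => _ [f [fi f1] <-].
have M0 : (0 <= M)%E by rewrite le_max Lnorm_ge0.
have uOd : {ae mu, forall x, Od x -> (`|u x|%:E <= M)%E}.
  have : {ae mrestr mu mOd, forall x, (`|u x|%:E <= M)%E}.
    (* If [Od] is null, the norm is $0$ by convention and gives no information on [u], but the whole
       space is then an exceptional set. *)
    have [Od0|Od0] := boolP (0 < mrestr mu mOd setT)%E; last first.
      exists setT; split => //; apply/eqP; rewrite eq_le measure_ge0 andbT.
      by rewrite leNgt.
    have le : (ess_sup (mrestr mu mOd) (abse \o (EFin \o u)) <= M)%E.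
      by rewrite le_max unlock Od0 lexx.
    by have /ess_supP := le.
  move=> [Z [mZ Z0 ZP]]; exists (Z `&` Od); split => //; first exact: measurableI.
  by move=> x /= /not_implyP[Ox nx]; split => //; exact: ZP.
have vM n : (N <= n)%N -> (`|v n|%:E <= M)%E.
  by move=> Nn; rewrite le_max; apply/orP; right; apply: ereal_sup_ubound; exists n.
(* As there are countably many atoms, one null set serves for all of them. *)
have uB : {ae mu, forall x n, B n x -> u x = v n} by exact/ae_foralln.
have fB : {ae mu, forall x n, B n x ->
    f x = (\int[mu]_(y in B n) f y)%R / fine (mu (B n))}.
  by apply/ae_foralln => n; apply: atom_eq_mean => //; exact: Rintegral_inL1.
move: M M0 uOd vM => [m| |//] M0 uOd vM; last by rewrite leey.
have mf := inL1_measurable mu fi; have [[K1 _ _] _] := cK.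
have mK := inL1_measurable mu (K1 _ fi).
rewrite lee_fin in M0.
apply: (@le_trans _ _ (L1norm mu (fun x => m * f x))); last first.
  by rewrite L1normZ// ger0_norm// -[leRHS]mule1 lee_wpmul2l// lee_fin.
rewrite !L1normE; apply: ae_ge0_le_integral => //.
- apply/measurable_EFinP/measurableT_comp => //; apply: measurable_funD => //.
  exact: measurable_funM.
- by apply/measurable_EFinP/measurableT_comp => //; exact: measurable_funM.
apply: filterS3 uOd uB fB => x uOd uB fB _.
rewrite lee_fin normrM (ger0_norm M0).
(* By disjointness only the [k]-th term survives at [x], and there the mean of [f] is [f x]. *)
have KE k : B k x -> K f x = if (k < N)%N then - v k * f x else 0.
  move=> Bk; have Bi i : i != k -> \1_(B i) x = 0 :> R.
    move=> ik; rewrite indicE memNset// => Bix; move/trivIsetP: tB => /(_ _ _ I I ik).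
    by rewrite -subset0 => /(_ x); exact.
  case: ifPn => kN; rewrite /K.
    rewrite (bigD1 (Ordinal kN))//= big1 ?addr0.
      by rewrite indicE mem_set// mulr1 (fB _ Bk) mulrCA.
    by move=> i ik; rewrite Bi ?mulr0.
  rewrite big1// => i _; rewrite Bi ?mulr0//; apply: contraNneq kN => <-.
  exact: ltn_ord.
have [Ox|] : (Od `|` Oa) x by rewrite OdUOa.
  have -> : K f x = 0.
    rewrite /K big1// => i _; rewrite indicE memNset ?mulr0// => Bix.
    by have : (Od `&` Oa) x; [split => //; rewrite OaE; exists i|rewrite OdOa].
  by rewrite addr0 normrM ler_wpM2r// -lee_fin uOd.
rewrite OaE => -[k _ Bk]; rewrite (KE _ Bk) /mult_op (uB _ Bk).
case: ltnP => kN.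
  by rewrite mulNr subrr normr0 mulr_ge0.
by rewrite addr0 normrM ler_wpM2r// -lee_fin vM.
Qed.

End essential_norm_bounds.

(** * Combination of the two bounds *)

Theorem theorem2p1 (d : measure_display) (T : measurableType d) (R : realType)
  (mu : {measure set T -> \bar R}) (Od Oa : set T) (B : nat -> set T)
  (u : T -> R) (mOd : measurable Od) :
  sigma_finite [set: T] mu ->
  measurable Oa ->
  Od `&` Oa = set0 -> Od `|` Oa = [set: T] ->
  diffuse_on mu Od ->
  Oa = \bigcup_n B n ->
  trivIset [set: nat] B ->
  (forall n, is_atom mu (B n)) ->
  u \in Lfun mu +oo%E ->
  L1_essnorm mu (mult_op u) =
    maxe (Lnorm (mrestr mu mOd) +oo%E (EFin \o u))
         (limn_esup (fun n => (`|atom_value mu u (B n)|)%:E)).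
Proof.
move=> sf mOa OdOa OdUOa dif OaE tB aB uL.
have um : measurable_fun setT u.
  by move: uL; rewrite inE => /andP[/[!inE]].
have Boo n := atom_finite mu sf (aB n).
have [M uM] : exists M : R, {ae mu, forall x, `|u x| <= M}.
  move: uL; rewrite inE => /andP[_]; rewrite inE/= /finite_norm.
  (* For the zero measure any bound holds almost everywhere, so $0$ is taken. *)
  have [T0|T0] := boolP (0 < mu setT)%E; last first.
    move=> _; exists 0, setT; split => //; apply/eqP.
    by rewrite eq_le measure_ge0 andbT leNgt.
  rewrite unlock T0 => uoo; exists (fine (ess_sup mu (abse \o (EFin \o u)))).
  have := ess_sup_ge mu (abse \o (EFin \o u)); apply: filterS => x /= le.
  by rewrite -lee_fin fineK// ge0_fin_numE// (le_trans _ le).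
have uv n := atom_valueP mu M (aB n) (Boo n) um uM.
have v0 n : mu (B n) = 0%E -> atom_value mu u (B n) = 0.
  by rewrite /atom_value => ->; rewrite eqxx.
apply/eqP; rewrite eq_le; apply/andP; split; last first.
  apply: le_ereal_inf_tmp => _ [K cK <-]; rewrite ge_max; apply/andP; split.
    exact: Lnorm_le_opnorm_diffuse.
  exact: limn_esup_le_opnorm_atoms.
(* If the maximum were smaller than the essential norm, so would be some tail supremum, from an
   index [N], and [essnorm_le] at this [N] would fail. *)
rewrite leNgt; apply/negP; rewrite gt_max => /andP[ltd].
rewrite limn_esup_inf => /ereal_inf_lt[_ [N _ <-] ltN].
have := essnorm_le mu mOd N OdOa OdUOa OaE tB aB Boo um uv.
by apply/negP; rewrite -ltNge gt_max ltd ltN.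
Qed.
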